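(* Let $E$ be a real Banach space of dimension at least two. (i) Let $G\subsetneq E$ be a $c$-John domain. Then there is an increasing function $\psi:[0,\infty)\to[0,\infty)$ such that every pair of points in $G$ can be joined by an arc $\gamma$ in $G$ which satisfies the $\psi$-natural condition. (ii) Conversely, let $\psi:[0,\infty)\to[0,\infty)$ be an increasing function and let $G\subsetneq E$ be a diameter $c$-John domain such that any two points in $G$ can be joined by a diameter $c$-John arc which satisfies the $\psi$-natural condition. Then $G$ is length $c'$-John for some constant $c'=c'(c,\psi)$ depending only on $c$ and $\psi$.
   Context: A domain is an open connected set. The norm is written $|\cdot|$; $\delta G=\overline G\setminus G$ is the boundary of $G$, and $\delta_G(x)=\inf\{|x-y|:y\in\delta G\}$ for $x\in G$. A curve is a continuous map from a closed interval; it joins its endpoints. For points $u,v$ on a curve $\gamma$, $\gamma[u,v]$ is the part of $\gamma$ from $u$ to $v$, $l$ denotes length, $\mathrm{diam}$ denotes diameter and $\mathrm{dist}$ distance in the norm metric. For $c\ge 1$, a domain $G\subsetneq E$ is $c$-John (also called length $c$-John) if each pair of points $x_1,x_2\in G$ can be joined by a curve $\gamma$ in $G$ with $\min_{j=1,2} l(\gamma[x_j,x])\le c\,\delta_G(x)$ for all $x\in\gamma$. A curve $\gamma$ in $G$ joining $x_1$ and $x_2$ is a diameter $c$-John arc if $\min_{j=1,2}\mathrm{diam}(\gamma[x_j,x])\le c\,\delta_G(x)$ for all $x\in\gamma$, and $G$ is diameter $c$-John if each pair of points in $G$ can be joined by a diameter $c$-John arc. The quasihyperbolic length of a rectifiable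 arc $\gamma$ in $G$ is $l_k(\gamma)=\int_\gamma \frac{|dz|}{\delta_G(z)}$, and the quasihyperbolic distance is $k_G(x,y)=\inf_\gamma l_k(\gamma)$ over all rectifiable arcs $\gamma$ in $G$ joining $x$ and $y$. $\mathrm{diam}_k$ denotes diameter with respect to $k_G$. A curve $\gamma$ in $G$ satisfies the $\psi$-natural condition if $$\mathrm{diam}_k(\gamma[x,y])\le\psi\left(\frac{\mathrm{diam}(\gamma[x,y])}{\mathrm{dist}(\gamma[x,y],\delta G)}\right)\quad\text{for every }x,y\in\gamma.$$ *)

(* Defs.v *)
From HB Require Import structures.
From mathcomp Require Import all_boot all_order all_algebra.
From mathcomp Require Import all_classical all_reals all_analysis.

Set Implicit Arguments.
Unset Strict Implicit.
Unset Printing Implicit Defensive.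

Import Order.TTheory GRing.Theory Num.Theory.
Import numFieldNormedType.Exports.

Local Open Scope classical_set_scope.
Local Open Scope ring_scope.

Section defs.
Context {R : realType} {E : completeNormedModType R}.
Implicit Types (G A B : set E) (x y : E) (a b c s t : R) (g : R -> E).

Definition bdry G : set E := closure G `\` G.

(* Real-valued: only used on nonempty sets, where the infimum is genuine. *)
Definition dist A B : R := inf [set r | exists2 x, A x & exists2 y, B y & r = `|x - y|].

Definition bdist G x : R := inf [set `|x - y| | y in bdry G].

(* Real-valued: only used on images of compact intervals, which are bounded. *)
Definition diam A : R := sup [set r | exists2 x, A x & exists2 y, A y & r = `|x - y|].

(* A curve is a map g considered on a compact interval `[a, b]; the values of g
   outside `[a, b] are irrelevant. The case a = b of a constant curve is allowed,
   so that a point is joined to itself by a (degenerate) arc. The part of the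
   curve between the points of parameters s <= t is g restricted to `[s, t]. *)
Definition curve_in G a b g : Prop :=
  [/\ a <= b, {within `[a, b], continuous g} & g @` `[a, b] `<=` G].

Definition joins a b g x y : Prop := g a = x /\ g b = y.

Definition is_arc a b g : Prop := {in `[a, b] &, injective g}.

Definition piece g s t : set E := g @` `[s, t].

Definition polygon_length a b g (p : seq R) : R :=
  \sum_(0 <= n < size p) `|g (nth b (a :: p) n.+1) - g (nth b (a :: p) n)|.

Definition length a b g : \bar R :=
  ereal_sup [set (polygon_length a b g p)%:E | p in itv_partition a b].

Definition rectifiable a b g : Prop := (length a b g < +oo)%E.

(* The arc length parametrization of a rectifiable curve, on [0, length a b g]:
   g takes the same value at all parameters t with length a t g = l. *)
Definition arclength_param a b g (l : R) : E :=
  g (xget a [set t | t \in `[a, b] /\ length a t g = l%:E]).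

Definition qh_length G a b g : \bar R :=
  (\int[@lebesgue_measure R]_(l in `[0%R, fine (length a b g)])
     ((bdist G (arclength_param a b g l))^-1)%:E)%E.

Definition qh_dist G x y : \bar R :=
  ereal_inf [set L | exists a b g,
    [/\ curve_in G a b g, is_arc a b g, rectifiable a b g,
        joins a b g x y & L = qh_length G a b g]].

Definition qh_diam G A : \bar R :=
  ereal_sup [set L | exists2 x, A x & exists2 y, A y & L = qh_dist G x y].

Definition domain G : Prop := open G /\ connected G.

Definition length_john_curve c G a b g : Prop :=
  forall t, t \in `[a, b] ->
    (mine (length a t g) (length t b g) <= (c * bdist G (g t))%:E)%E.

Definition diam_john_curve c G a b g : Prop :=
  forall t, t \in `[a, b] ->
    Num.min (diam (piece g a t)) (diam (piece g t b)) <= c * bdist G (g t).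

Definition length_john c G : Prop :=
  [/\ 1 <= c, domain G, G != setT &
    forall x y, G x -> G y -> exists a b g,
      [/\ curve_in G a b g, joins a b g x y & length_john_curve c G a b g]].

Definition diam_john c G : Prop :=
  [/\ 1 <= c, domain G, G != setT &
    forall x y, G x -> G y -> exists a b g,
      [/\ curve_in G a b g, joins a b g x y & diam_john_curve c G a b g]].

Definition natural_condition (psi : R -> R) G a b g : Prop :=
  forall s t, a <= s -> s <= t -> t <= b ->
    (qh_diam G (piece g s t) <=
       (psi (diam (piece g s t) / dist (piece g s t) (bdry G)))%:E)%E.

End defs.

Definition dim_ge2 (R : realType) (E : completeNormedModType R) : Prop :=
  exists u v : E, forall a b : R, a *: u + b *: v = 0 -> a = 0 /\ b = 0.

(* Functions [0, oo) -> [0, oo) are represented by functions on R, of which only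
   the values on [0, oo) matter. Of the two readings of "increasing", the strict
   one is the stronger in a conclusion and the weak one is the more general in a
   hypothesis. *)
Definition maps_nonneg (R : realType) (psi : R -> R) : Prop :=
  forall r, 0 <= r -> 0 <= psi r.

Definition increasing_nonneg (R : realType) (psi : R -> R) : Prop :=
  forall r s, 0 <= r -> r < s -> psi r < psi s.

Definition nondecreasing_nonneg (R : realType) (psi : R -> R) : Prop :=
  forall r s, 0 <= r -> r <= s -> psi r <= psi s.

(* Main.v *)
Require Import Defs.
From HB Require Import structures.
From mathcomp Require Import all_boot all_order all_algebra.
From mathcomp Require Import all_classical all_reals all_analysis.
From mathcomp Require Import ring lra.
Import Order.TTheory GRing.Theory Num.Theory.
Import numFieldNormedType.Exports.
Local Open Scope classical_set_scope.
Local Open Scope ring_scope.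

(** In both parts the curves are handled through 1-Lipschitz maps [h] on an
    interval [[0, L]]: they are continuous, the length of [h] between [s] and [t]
    is at most [t - s], and Lipschitz pieces glue to Lipschitz curves. Length
    estimates then become estimates of parameters.

    Part (i). Let [h] be an injective 1-Lipschitz map on [[0, L]] that satisfies
    the John condition [min l (L - l) <= C * bdist (h l)]. On a piece of diameter
    [D] at distance [d] from the boundary, [bdist <= d + D], so the John condition
    at the ends of the piece (or at the middle parameter, if it lies inside)
    bounds the parameter length of the piece by [2 * C * (d + D)]. As
    [1 / bdist <= 1 / d] along it, its quasihyperbolic diameter is at most
    [2 * C * (1 + D / d)], which is the natural condition with an affine function
    of [D / d] ([john_arc_natural]). It remains to turn a John curve into such an
    arc. One follows the curve by short segments and, each time a segment is
    added, erases the loop that it closes ([loop_erasure]); erasing loops only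
    shortens the lengths from both ends, so the John condition survives with the
    constant [2 * c] ([john_arc]).

    Part (ii). Let [m] be a point of the diameter John curve where the two parts
    have the same diameter. On the part from [g a] to [m] the John condition
    reads [D t <= c * bdist (g t)], where [D t] is the diameter of the part
    from [g a] to [g t]. This function is continuous; let [s] be such that
    [D s = D t / 2]. The piece from [s] to [t] has diameter at most [D t] and
    distance at least [D t / (2 * c)] to the boundary, hence by the natural
    condition its ends have quasihyperbolic distance at most [psi (2 * c)].
    Replace the piece by an arc of quasihyperbolic length less than
    [M = psi (2 * c) + 1]. Along it the distance to the boundary changes at most
    by the factor [expR M], and its length is at most [expR M] times that distance
    ([qh_short_path]). As long as [D t] is not small compared to [bdist (g a)],
    all these quantities are comparable to [D t]; once [D t <= bdist (g a) / 2] a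
    segment does the rest. The lengths form a geometric series, so that the
    length from [g a] is bounded by a constant times the distance to the boundary
    ([cone_half]). The two halves glue at [m] ([glue_cones]). *)

(** * Continuity on an interval in terms of epsilon and delta *)

Section continuity.
Context {R : realType} {V : normedModType R}.
Implicit Types (g : R -> V) (a b x y e d : R).

(** The form of [{within `[a, b], continuous g}] that passes to subintervals and
    reversed curves without topology. *)
Definition ects a b g := forall x, a <= x <= b -> forall e, 0 < e ->
  exists2 d, 0 < d & forall y, a <= y <= b -> `|x - y| < d -> `|g x - g y| < e.

Lemma itv_sub (a s u t b : R) : a <= s -> t <= b -> s <= u <= t -> a <= u <= b.
Proof. by move=> a_s tb /andP[su ut]; rewrite (le_trans a_s su) (le_trans ut tb). Qed.

Lemma itv_rev (a b u : R) : - b <= u <= - a -> a <= - u <= b.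
Proof. by rewrite andbC lerNr lerNl. Qed.

Lemma within_ects a b g : {within `[a, b], continuous g} -> ects a b g.
Proof.
move=> /subspace_continuousP gc x xab e e0.
have /gc : `[a, b]%classic x by rewrite /= in_itv.
move=> /cvgrPdist_lt /(_ e e0).
rewrite near_withinE => /nbhs_ballP[d /= d0 dP].
exists d => // y yab xy; by apply: dP; rewrite //= in_itv.
Qed.

Lemma ects_within a b g : ects a b g -> {within `[a, b], continuous g}.
Proof.
move=> gc; apply/subspace_continuousP => x; rewrite /= in_itv /= => xab.
apply/cvgrPdist_lt => e e0; have [d d0 dP] := gc x xab e e0.
rewrite near_withinE; apply/nbhs_ballP; exists d => //= y xy.
by rewrite in_itv /= => yab; exact: dP.
Qed.

Lemma ects_sub a b s t g : a <= s -> t <= b -> ects a b g -> ects s t g.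
Proof.
move=> sa tb gc x xst e e0; have [d d0 dP] := gc x (itv_sub _ _ _ _ _ sa tb xst) e e0.
by exists d => // y yst; apply: dP; exact: itv_sub yst.
Qed.

Lemma ects_rev a b g : ects a b g -> ects (- b) (- a) (fun t => g (- t)).
Proof.
move=> gc x /andP[x1 x2] e e0.
have [|d d0 dP] := gc (- x) _ e e0; first by apply/andP; split; lra.
exists d => // y /andP[y1 y2] xy; apply: dP; first by apply/andP; split; lra.
by rewrite -opprD normrN.
Qed.

End continuity.

(** * Maps that do not increase distances *)

Section lipschitz.
Context {R : realType} {V : normedModType R}.
Implicit Types (g h : R -> V) (a b s t : R).

Definition lip1 a b h := forall s t, a <= s -> s <= t -> t <= b ->
  `|h s - h t| <= t - s.

Lemma lip1_sub a b s t h : a <= s -> t <= b -> lip1 a b h -> lip1 s t h.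
Proof. by move=> sa tb hl u v su uv vt; apply: hl => //; lra. Qed.

Lemma lip1_ects a b h : lip1 a b h -> ects a b h.
Proof.
move=> hl x /andP[ax xb] e e0; exists e => // y /andP[ay yb] xy.
have [le_xy|lt_yx] := leP x y.
  by apply: (le_lt_trans (hl _ _ ax le_xy yb)); move: xy; rewrite ltr_norml; lra.
rewrite distrC; apply: (le_lt_trans (hl _ _ ay (ltW lt_yx) xb)).
by move: xy; rewrite ltr_norml; lra.
Qed.

Lemma lip1_rev a b h : lip1 a b h -> lip1 (- b) (- a) (fun t => h (- t)).
Proof.
move=> hl s t bs st ta; rewrite distrC.
by apply: le_trans (hl (- t) (- s) _ _ _) _; lra.
Qed.

Lemma lip1_shift a b c h : lip1 a b h -> lip1 (a + c) (b + c) (fun t => h (t - c)).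
Proof.
move=> hl s t bs st ta.
by apply: le_trans (hl (s - c) (t - c) _ _ _) _; lra.
Qed.

Definition glue m h k t : V := if t <= m then h t else k t.

Lemma glueL m h k t : t <= m -> glue m h k t = h t.
Proof. by rewrite /glue => ->. Qed.

Lemma glueR m h k t : h m = k m -> m <= t -> glue m h k t = k t.
Proof.
rewrite /glue => hk mt; case: ifPn => // tm.
by have -> : t = m by apply/eqP; rewrite eq_le mt tm.
Qed.

(** For parameters on both sides of [m] the triangle inequality passes through
    the common value at [m]. *)
Lemma lip1_glue a m b h k : h m = k m -> lip1 a m h -> lip1 m b k ->
  lip1 a b (glue m h k).
Proof.
move=> hk hl kl s t sa st tb.
have [tm|mt] := leP t m.
  by rewrite !glueL ?(le_trans st tm)//; exact: hl.
have [sm|ms] := leP s m; last first.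
  by rewrite !(glueR _ _ _ _ hk); [apply: kl; lra|lra..].
rewrite (glueL _ _ _ s)// (glueR _ _ _ _ hk (ltW mt)).
apply: (le_trans (ler_distD (h m) _ _)).
have := hl s m sa sm (lexx _); have := kl m t (lexx _) (ltW mt) tb.
by rewrite hk; lra.
Qed.

(** The segment from [p] to [q] run at unit speed. *)
Definition seg p q t : V := p + (t / `|q - p|) *: (q - p).

Lemma seg0 p q : seg p q 0 = p.
Proof. by rewrite /seg mul0r scale0r addr0. Qed.

Lemma seg1 p q : seg p q `|q - p| = q.
Proof.
rewrite /seg; have [->|qp] := eqVneq q p; first by rewrite subrr scaler0 addr0.
by rewrite divff ?normr_eq0 ?subr_eq0// scale1r subrKC.
Qed.

Lemma lip1_seg a b p q : lip1 a b (seg p q).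
Proof.
move=> s t _ st _; rewrite /seg opprD addrACA subrr add0r -scalerBl normrZ -mulrBl.
have [->|qp] := eqVneq q p; first by rewrite subrr normr0 mulr0; lra.
rewrite normrM normfV normr_id mulfVK ?normr_eq0 ?subr_eq0//.
by rewrite distrC ger0_norm//; lra.
Qed.

End lipschitz.

(** * The distance to the boundary of an open set *)

Section boundary.
Context {R : realType} {E : completeNormedModType R}.
Implicit Types (G : set E) (x y z : E).

(** Leaving [G] along a segment, one first meets the boundary at the supremum
    of the parameters up to which the segment stays in [G]. *)
Lemma bdry_on_segment G x y : open G -> G x -> ~ G y ->
  exists2 w, bdry G w & `|x - w| <= `|x - y|.
Proof.
move=> Go Gx Gy; pose h := seg x y; pose d := `|y - x|.
have d0 : 0 < d.
  rewrite normr_gt0 subr_eq0; apply/eqP => yx; apply: Gy; by rewrite yx.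
pose S := [set t : R | 0 <= t <= d /\ forall s : R, 0 <= s <= t -> G (h s)].
have S0 : S 0.
  split; first by rewrite lexx ltW.
  by move=> s /andP[s0 s1]; rewrite (_ : s = 0) /h ?seg0//; lra.
have Sub : ubound S d by move=> t [/andP[]].
have Ssup : has_sup S by split; [exists 0|exists d].
pose T := sup S.
have T0 : 0 <= T by apply: sup_upper_bound S0.
have Td : T <= d by apply: ge_sup => //; exists 0.
have GT (s : R) : 0 <= s < T -> G (h s).
  move=> /andP[s0 sT]; have Ts : 0 < T - s by rewrite subr_gt0.
  have [t [_ tS] st] := sup_adherent Ts Ssup.
  by apply: tS; rewrite s0 /=; move: st; rewrite -/T; lra.
have hl := lip1_seg 0 d x y.
have nGT : ~ G (h T).
  move=> G0; have TD : T < d.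
    rewrite lt_neqAle Td andbT; apply/eqP => Tdd; apply: Gy.
    by rewrite -(seg1 x y) -/d -Tdd.
  have [e /= e0 eP] : nbhs_ball (h T) G by apply/nbhs_ballP/open_nbhs_nbhs.
  pose T' := Num.min d (T + e / 2).
  have TT' : T < T' by rewrite lt_min TD; lra.
  have T'1 : T' <= d by rewrite ge_min lexx.
  have T'2 : T' <= T + e / 2 by rewrite ge_min lexx orbT.
  suff /(sup_upper_bound Ssup) : S T' by rewrite -/T; lra.
  split; first by rewrite T'1 andbT; lra.
  move=> s /andP[s0 sT']; have [sT|Ts] := ltP s T; first by apply: GT; rewrite s0.
  apply: eP; rewrite -ball_normE /=.
  by apply: le_lt_trans (hl T s T0 Ts _) _; lra.
exists (h T).
  split=> // B /nbhs_ballP[e /= e0 eP].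
  have [T0'|T0'] := eqVneq T 0.
    by exfalso; apply: nGT; rewrite T0' /h seg0.
  have Tp : 0 < T by rewrite lt_def T0'.
  pose s := Num.max 0 (T - e / 2).
  have s0 : 0 <= s by rewrite le_max lexx.
  have s1 : T - e / 2 <= s by rewrite le_max lexx orbT.
  have sT : s < T by rewrite gt_max Tp; lra.
  exists (h s); split; first by apply: GT; rewrite s0.
  apply: eP; rewrite -ball_normE /= distrC.
  by apply: le_lt_trans (hl s T s0 (ltW sT) Td) _; lra.
have := hl 0 T (lexx _) T0 Td; rewrite /h seg0 => /le_trans; apply.
by rewrite subr0 distrC.
Qed.

Lemma bdry_nonempty G x : open G -> G x -> G != setT -> bdry G !=set0.
Proof.
move=> Go Gx GT; have [y Gy] : exists y, ~ G y.
  apply: contrapT => /forallNP nG; move/eqP: GT; apply.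
  by apply/seteqP; split=> // y _; apply: contrapT; exact: nG.
by have [w wG _] := bdry_on_segment _ _ _ Go Gx Gy; exists w.
Qed.

Lemma bdist_le G x w : bdry G w -> bdist G x <= `|x - w|.
Proof.
move=> wG; apply: ge_inf; last by exists w.
by exists 0 => _ [z _ <-].
Qed.

Lemma le_bdist G x r : bdry G !=set0 -> (forall w, bdry G w -> r <= `|x - w|) ->
  r <= bdist G x.
Proof.
move=> [w wG] rP; apply: lb_le_inf; first by exists `|x - w|, w.
by move=> _ [z zG <-]; exact: rP.
Qed.

Lemma bdist_lip G x y : bdry G !=set0 -> bdist G x <= bdist G y + `|x - y|.
Proof.
move=> G0; rewrite -lerBlDr; apply: le_bdist => // w wG.
rewrite lerBlDr; apply: (le_trans (bdist_le G x w wG)).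
by rewrite (le_trans (ler_distD y _ _))// addrC.
Qed.

(** A segment leaving [G] would meet the boundary before its end. *)
Lemma bdist_ball G x y : open G -> G x -> `|x - y| < bdist G x -> G y.
Proof.
move=> Go Gx xy; apply: contrapT => Gy.
have [w wG] := bdry_on_segment _ _ _ Go Gx Gy.
by have := bdist_le G x w wG; lra.
Qed.

Lemma bdist_gt0 G x : open G -> bdry G !=set0 -> G x -> 0 < bdist G x.
Proof.
move=> Go G0 Gx.
have [e /= e0 eP] : nbhs_ball x G by apply/nbhs_ballP/open_nbhs_nbhs.
apply: (lt_le_trans e0); apply: le_bdist => // w [_ wG].
by rewrite leNgt; apply/negP => we; apply/wG/eP; rewrite -ball_normE.
Qed.

End boundary.

(** * Length of curves and parametrization by arc length *)

Section length.
Context {R : realType} {E : completeNormedModType R}.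
Implicit Types (g h : R -> E) (a b s t l : R) (p q : seq R).

Lemma polygon_length_nil a b g : polygon_length a b g [::] = 0.
Proof. by rewrite /polygon_length big_nil. Qed.

Lemma polygon_length_cons a b g t p :
  polygon_length a b g (t :: p) = `|g t - g a| + polygon_length t b g p.
Proof. by rewrite /polygon_length /= big_nat_recl. Qed.

Lemma polygon_length_cat a s b g p q : itv_partition a s p ->
  polygon_length a b g (p ++ q) = polygon_length a s g p + polygon_length s b g q.
Proof.
elim: p a => [|t p IH] a.
  by move=> /itv_partition_nil ->; rewrite polygon_length_nil add0r.
move=> /itv_partition_cons pP.
by rewrite /= !polygon_length_cons IH// addrA.
Qed.

Lemma itv_partition_lt a b t p : itv_partition a b (t :: p) -> a < t.
Proof. by case=> /= /andP[]. Qed.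

Lemma polygon_le_length a b g p : itv_partition a b p ->
  ((polygon_length a b g p)%:E <= length a b g)%E.
Proof. by move=> pP; apply: ereal_sup_ubound; exists p. Qed.

Lemma length_le a b g l :
  (forall p, itv_partition a b p -> polygon_length a b g p <= l) ->
  (length a b g <= l%:E)%E.
Proof. by move=> lP; apply: ge_ereal_sup => _ [p /lP pl <-]; rewrite lee_fin. Qed.

Lemma length_leP a b g (l : \bar R) :
  (forall p, itv_partition a b p -> ((polygon_length a b g p)%:E <= l)%E) ->
  (length a b g <= l)%E.
Proof. by move=> lP; apply: ge_ereal_sup => _ [p /lP pl <-]. Qed.

Lemma chord_le_length a b g : a <= b -> (`|g a - g b|%:E <= length a b g)%E.
Proof.
rewrite le_eqVlt => /predU1P[->|ab].
  rewrite subrr normr0 -(polygon_length_nil b b g).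
  by apply: polygon_le_length; split.
have := polygon_le_length a b g [:: b] (itv_partition1 ab).
by rewrite polygon_length_cons polygon_length_nil addr0 distrC.
Qed.

Lemma length_ge0 a b g : a <= b -> (0 <= length a b g)%E.
Proof. by move=> ab; apply: le_trans (chord_le_length _ _ g ab); rewrite lee_fin. Qed.

(** A partition of [[a, s]] followed by one of [[s, b]] partitions [[a, b]].
    The suprema are taken one after the other, the first while the partition of
    [[s, b]] is fixed. *)
Lemma length_superadd a s b g : a <= s -> s <= b ->
  (length a s g + length s b g <= length a b g)%E.
Proof.
move=> a_s sb; have := length_ge0 _ _ g (le_trans a_s sb).
have pq p q : itv_partition a s p -> itv_partition s b q ->
    ((polygon_length a s g p + polygon_length s b g q)%:E <= length a b g)%E.
  move=> pP qP; rewrite -polygon_length_cat//.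
  by apply: polygon_le_length; exact: itv_partition_cat qP.
case: (length a b g) pq => [L| |//] pq _; last exact: leey.
have bq q : itv_partition s b q ->
    (length a s g <= (L - polygon_length s b g q)%:E)%E.
  by move=> qP; apply: length_le => p pP; have := pq p q pP qP; rewrite lee_fin; lra.
have [q qP] : exists q, itv_partition s b q.
  move: sb; rewrite le_eqVlt => /predU1P[->|sb]; first by exists [::]; split.
  by exists [:: b]; exact: itv_partition1.
have := length_ge0 _ _ g a_s; have := bq q qP.
case: (length a s g) bq => [K| |//] bq // _ _.
have : (length s b g <= (L - K)%:E)%E.
  by apply: length_le => p /bq; rewrite lee_fin; lra.
move=> /(leeD2l K%:E) /le_trans; apply; rewrite -EFinD lee_fin; lra.
Qed.

(** Along a partition of [[a, b]], every edge before the one that jumps over [s]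
    is absorbed in the length from [a] to [s], and that edge is split at [s]. *)
Lemma length_subadd a s b g : a <= s -> s <= b ->
  (length a b g <= length a s g + length s b g)%E.
Proof.
move=> a_s sb; apply: length_leP => p; elim: p a a_s => [|t p IH] a a_s pP.
  rewrite polygon_length_nil; apply: adde_ge0; exact: length_ge0.
have a_t := ltW (itv_partition_lt _ _ _ _ pP); have pP' := itv_partition_cons pP.
rewrite polygon_length_cons EFinD; have [ts|st] := leP t s.
  apply: (le_trans (leeD2l _ (IH t ts pP'))); rewrite addeA; apply: leeD2r.
  apply: le_trans (length_superadd _ _ _ _ a_t ts); apply: leeD2r.
  by rewrite distrC; exact: chord_le_length.
apply: (@le_trans _ _ (`|g a - g s|%:E + (`|g s - g t|%:E + length t b g)%E)%E).
  rewrite addeA; apply: leeD; last exact: polygon_le_length.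
  by rewrite -EFinD lee_fin distrC; exact: ler_distD.
apply: leeD; first exact: chord_le_length.
apply: le_trans (length_superadd s t b g (ltW st) (itv_partition_le pP')).
by apply: leeD2r; apply/chord_le_length/ltW.
Qed.

Lemma length_lip a b h : a <= b -> lip1 a b h -> (length a b h <= (b - a)%:E)%E.
Proof.
move=> ab hl; apply: length_le => p; elim: p a ab hl => [|t p IH] a ab hl pP.
  by rewrite polygon_length_nil subr_ge0.
have a_t := ltW (itv_partition_lt _ _ _ _ pP); have pP' := itv_partition_cons pP.
have tb := itv_partition_le pP'.
have := IH t tb (lip1_sub _ _ _ _ _ a_t (lexx _) hl) pP'.
have := hl a t (lexx _) a_t tb.
by rewrite polygon_length_cons distrC; lra.
Qed.

(** Lower semicontinuity from the left: in a partition of [[a, t]] the last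
    vertex can be moved from [t] to a nearby earlier parameter. *)
Lemma length_lsc_left a t g M : a < t -> ects a t g ->
  (forall s, a <= s < t -> (length a s g <= M%:E)%E) -> (length a t g <= M%:E)%E.
Proof.
move=> lt_at gc sM.
have near_le p a' : a <= a' -> a' < t -> itv_partition a' t p -> forall e, 0 < e ->
    exists2 s0, a' <= s0 < t & forall s, s0 < s < t -> `|g t - g s| <= e ->
      ((polygon_length a' t g p)%:E <= length a' s g + e%:E)%E.
  elim: p a' => [|u p IH] a' aa' a't pP e e0.
    by move: a't; rewrite (itv_partition_nil pP) ltxx.
  have a'u := itv_partition_lt _ _ _ _ pP; have pP' := itv_partition_cons pP.
  have := itv_partition_le pP'; rewrite le_eqVlt => /predU1P[ut|ut].
    subst u; exists a'; first by rewrite lexx.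
    move=> s /andP[a's st] gst.
    rewrite (itv_partitionxx pP') polygon_length_cons polygon_length_nil addr0.
    apply: (@le_trans _ _ (`|g a' - g s|%:E + e%:E)%E).
      rewrite -EFinD lee_fin distrC; apply: (le_trans (ler_distD (g s) _ _)).
      by rewrite lerD2l distrC.
    by apply: leeD2r; apply/chord_le_length/ltW.
  have [|s0 /andP[us0 s0t] s0P] := IH u _ ut pP' e e0; first lra.
  exists s0; first by apply/andP; split => //; lra.
  move=> s /andP[s0s st] gst; rewrite polygon_length_cons EFinD.
  apply: (@le_trans _ _ (`|g u - g a'|%:E + (length u s g + e%:E))%E).
    by apply: leeD2l; apply: s0P => //; rewrite s0s.
  rewrite addeA; apply: leeD2r.
  have us : u <= s by lra.
  apply: le_trans (length_superadd _ _ _ _ (ltW a'u) us); apply: leeD2r.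
  by rewrite distrC; apply/chord_le_length/ltW.
apply: length_le => p pP; apply/ler_addgt0Pr => e e0.
have [s0 /andP[as0 s0t] s0P] := near_le p a (lexx _) lt_at pP e e0.
have [|d d0 dP] := gc t _ e e0; first by rewrite lexx ltW.
pose s := Num.max ((s0 + t) / 2) (t - d / 2).
have st : s < t by rewrite gt_max; apply/andP; split; lra.
have s0s : s0 < s by rewrite lt_max; apply/orP; left; lra.
have ds : t - d / 2 <= s by rewrite le_max lexx orbT.
have := s0P s; rewrite s0s st => /(_ isT) H.
rewrite -lee_fin; apply: (le_trans (H _)).
  apply/ltW/dP; first by rewrite (ltW st) andbT; lra.
  by rewrite ger0_norm; lra.
by rewrite EFinD; apply: leeD2r; apply: sM; apply/andP; split; lra.
Qed.

(** Only the first edge of a partition is affected when [t] moves to the right. *)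
Lemma length_lsc_right t b g M : t < b -> ects t b g ->
  (forall s, t < s <= b -> (length s b g <= M%:E)%E) -> (length t b g <= M%:E)%E.
Proof.
move=> tb gc sM; apply: length_le => -[|u p] pP.
  by move: tb; rewrite (itv_partition_nil pP) ltxx.
have tu := itv_partition_lt _ _ _ _ pP; have pP' := itv_partition_cons pP.
have ub := itv_partition_le pP'.
apply/ler_addgt0Pr => e e0; have [|d d0 dP] := gc t _ e e0; first by rewrite lexx ltW.
pose s := Num.min u (t + d / 2).
have ts : t < s by rewrite lt_min tu; lra.
have su : s <= u by rewrite ge_min lexx.
have ds : s <= t + d / 2 by rewrite ge_min lexx orbT.
rewrite polygon_length_cons -lee_fin.
apply: (@le_trans _ _ (e%:E + (`|g s - g u|%:E + length u b g))%E).
  rewrite EFinD addeA; apply: leeD; last exact: polygon_le_length.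
  rewrite -EFinD lee_fin distrC; apply: (le_trans (ler_distD (g s) _ _)).
  rewrite lerD2r; apply/ltW/dP; first by apply/andP; split; lra.
  by rewrite ltr_norml; apply/andP; split; lra.
rewrite (addrC M) EFinD; apply: leeD2l.
have sb : s <= b by lra.
apply: le_trans (sM s _); last by rewrite ts.
apply: le_trans (length_superadd _ _ _ _ su ub); apply: leeD2r.
exact: chord_le_length.
Qed.

(** With [t] the supremum of the parameters up to which the length is at most
    [l], semicontinuity bounds the length before [t] by [l] and the length
    after [t] by the complement of [l]; additivity makes both equalities. *)
Lemma length_surj a b g L l : a <= b -> ects a b g -> length a b g = L%:E ->
  0 <= l <= L -> exists2 t, a <= t <= b & length a t g = l%:E.
Proof.
move=> ab gc gL /andP[l0 lL].
have lenxx x : length x x g = 0%E.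
  apply/eqP; rewrite eq_le length_ge0// andbT; apply: length_leP => p pP.
  by rewrite (itv_partitionxx pP) polygon_length_nil.
pose S := [set t : R | a <= t <= b /\ (length a t g <= l%:E)%E].
have Sa : S a by split; rewrite ?lexx// lenxx lee_fin.
have Sb : ubound S b by move=> t [/andP[]].
have Ssup : has_sup S by split; [exists a|exists b].
pose t := sup S.
have a_t : a <= t by apply: sup_upper_bound Sa.
have tb : t <= b by apply: ge_sup => //; exists a.
have Vt : (length a t g <= l%:E)%E.
  move: (a_t); rewrite le_eqVlt => /predU1P[<-|lt_at]; first by rewrite lenxx lee_fin.
  apply: length_lsc_left => //; first exact: ects_sub gc.
  move=> s /andP[a_s st].
  have [|u [/andP[au ub] uS] su] := sup_adherent (eps := t - s) _ Ssup; first lra.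
  have {}su : s <= u by move: su; rewrite -/t; lra.
  apply: le_trans uS; apply: le_trans (length_superadd _ _ _ _ a_s su).
  by apply: leeDl; exact: length_ge0.
have Wt : (length t b g <= (L - l)%:E)%E.
  move: (tb); rewrite le_eqVlt => /predU1P[->|lt_tb].
    by rewrite lenxx lee_fin; lra.
  apply: length_lsc_right => //; first exact: ects_sub gc.
  move=> s /andP[ts sb]; have a_s : a <= s by lra.
  have : (l%:E < length a s g)%E.
    rewrite ltNge; apply/negP => sl.
    suff /(sup_upper_bound Ssup) : S s by rewrite leNgt -/t ts.
    by split=> //; rewrite a_s.
  have := length_superadd _ _ _ g a_s sb; rewrite gL.
  have := length_ge0 _ _ g sb.
  case: (length a s g) => [x| |]//; case: (length s b g) => [y| |]//.
  by rewrite -EFinD !lee_fin lte_fin; lra.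
exists t; first by rewrite a_t.
have := length_subadd _ _ _ g a_t tb; rewrite gL.
have := length_ge0 _ _ g a_t; have := length_ge0 _ _ g tb; move: Vt Wt.
case: (length a t g) => [x| |]//; case: (length t b g) => [y| |]//.
rewrite -EFinD !lee_fin => *; congr (_%:E); lra.
Qed.

(** On [[0, L]] the surjectivity of the length function gives each value a
    genuine parameter; elsewhere the default value of [xget] still gives a point
    of the curve, so that [h] never leaves the image of [g]. *)
Lemma arclength_param_lip1 a b g L (h := arclength_param a b g) :
  a <= b -> ects a b g -> length a b g = L%:E ->
  [/\ 0 <= L, lip1 0 L h, h 0 = g a, h L = g b &
    forall l, exists2 t, a <= t <= b & h l = g t].
Proof.
move=> ab gc gL; have L0 : 0 <= L by rewrite -lee_fin -gL length_ge0.
have hP l : 0 <= l <= L -> exists t, [/\ a <= t <= b, length a t g = l%:E & h l = g t].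
  move=> /(length_surj _ _ _ _ _ ab gc gL)[t tab tl].
  rewrite /h /arclength_param; case: xgetP => [u _ []|/(_ t)]; last first.
    by case; split=> //; rewrite in_itv.
  by rewrite in_itv /= => uab ul; exists u.
have hl : lip1 0 L h.
  move=> l m l0 lm mL.
  have [|s [/andP[a_s sb] sl ->]] := hP l; first by apply/andP; split; lra.
  have [|t [/andP[a_t tb] tm ->]] := hP m; first by apply/andP; split; lra.
  rewrite -lee_fin; have [st|/ltW ts] := leP s t.
    have := length_superadd _ _ _ g a_s st; have := chord_le_length _ _ g st.
    rewrite sl tm; case: (length s t g) => [x| |]//.
    by rewrite -EFinD !lee_fin; lra.
  have := length_superadd _ _ _ g a_t ts; have := chord_le_length _ _ g ts.
  rewrite sl tm distrC; case: (length t s g) => [x| |]//.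
  by rewrite -EFinD !lee_fin; lra.
split=> //.
- have [|t [/andP[a_t tb] t0 ->]] := hP 0; first by rewrite lexx.
  have := chord_le_length _ _ g a_t; rewrite t0 lee_fin normr_le0 subr_eq0.
  by move=> /eqP.
- have [|t [/andP[a_t tb] tL ->]] := hP L; first by rewrite lexx L0.
  have := chord_le_length _ _ g tb; have := length_superadd _ _ _ g a_t tb.
  rewrite gL tL; case: (length t b g) => [x| |]//; rewrite -EFinD !lee_fin => x0 gx.
  have : `|g t - g b| <= 0 by lra.
  by rewrite normr_le0 subr_eq0 => /eqP.
- move=> l; rewrite /h /arclength_param; case: xgetP => [u _ []|_].
    by rewrite in_itv => uab _; exists u.
  by exists a; rewrite ?lexx.
Qed.

End length.

(** * Diameter of the pieces of a curve *)

Section diameter.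
Context {R : realType} {E : completeNormedModType R}.
Implicit Types (G : set E) (g : R -> E) (a b s t u v : R).

Lemma ects_lip {V W : normedModType R} a b (g : R -> V) (F : R -> W) :
  ects a b g ->
  (forall s t, a <= s <= b -> a <= t <= b -> `|F s - F t| <= `|g s - g t|) ->
  ects a b F.
Proof.
move=> gc Fg x xab e e0; have [d d0 dP] := gc x xab e e0.
by exists d => // y yab xy; apply: le_lt_trans (dP y yab xy); exact: Fg.
Qed.

Lemma ects_bounded a b g : a <= b -> ects a b g ->
  exists M, forall t, a <= t <= b -> `|g t| <= M.
Proof.
move=> ab gc; have nc : ects (V := R) a b (fun t => `|g t|).
  by apply: (ects_lip _ _ _ _ gc) => s t _ _; exact: ler_dist_dist.
have [c _ cM] := EVT_max ab (ects_within _ _ _ nc).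
by exists `|g c| => t tab; apply: cM; rewrite in_itv.
Qed.

Lemma pieceP g s t x : piece g s t x <-> exists2 u, s <= u <= t & g u = x.
Proof. by split=> -[u uP <-]; exists u => //; move: uP; rewrite /= in_itv. Qed.

Lemma piece_has_sup g s t : s <= t -> ects s t g ->
  has_sup [set r | exists2 x, piece g s t x & exists2 y, piece g s t y & r = `|x - y|].
Proof.
move=> st gc; have [M gM] := ects_bounded _ _ _ st gc; split.
  have ps : piece g s t (g s) by apply/pieceP; exists s; rewrite ?lexx.
  by exists `|g s - g s|, (g s) => //; exists (g s).
exists (M + M) => _ [x /pieceP[u uP <-] [y /pieceP[v vP <-] ->]].
by apply: (le_trans (ler_normB _ _)); apply: lerD; exact: gM.
Qed.

Lemma le_diam g s t u v : ects s t g -> s <= u <= t -> s <= v <= t ->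
  `|g u - g v| <= diam (piece g s t).
Proof.
move=> gc uP vP; have st : s <= t by case/andP: uP => /le_trans; apply.
apply: (sup_upper_bound (piece_has_sup _ _ _ st gc)).
by exists (g u); [apply/pieceP; exists u|exists (g v) => //; apply/pieceP; exists v].
Qed.

Lemma diam_le g s t M : s <= t ->
  (forall u v, s <= u <= t -> s <= v <= t -> `|g u - g v| <= M) ->
  diam (piece g s t) <= M.
Proof.
move=> st gM; apply: ge_sup.
  have ps : piece g s t (g s) by apply/pieceP; exists s; rewrite ?lexx.
  by exists `|g s - g s|, (g s) => //; exists (g s).
by move=> _ [x /pieceP[u uP <-] [y /pieceP[v vP <-] ->]]; exact: gM.
Qed.

Lemma diam_ge0 g s t : s <= t -> ects s t g -> 0 <= diam (piece g s t).
Proof.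
by move=> st gc; apply: le_trans (le_diam _ _ _ s s gc _ _); rewrite ?lexx.
Qed.

Lemma diam_mono g s t s' t' : s' <= s -> s <= t -> t <= t' -> ects s' t' g ->
  diam (piece g s t) <= diam (piece g s' t').
Proof.
move=> s's st tt' gc; apply: diam_le => // u v uP vP.
by apply: le_diam => //; [exact: itv_sub uP|exact: itv_sub vP].
Qed.

(** Two points on different sides of [m] are compared through [g m]. *)
Lemma diam_cat g s m t : s <= m -> m <= t -> ects s t g ->
  diam (piece g s t) <= diam (piece g s m) + diam (piece g m t).
Proof.
move=> sm mt gc.
have gc1 : ects s m g by apply: ects_sub gc.
have gc2 : ects m t g by apply: ects_sub gc.
have d1 := diam_ge0 _ _ _ sm gc1; have d2 := diam_ge0 _ _ _ mt gc2.
apply: diam_le => [|u v /andP[su ut] /andP[sv vt]]; first lra.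
have [um|mu] := leP u m; have [vm|mv] := leP v m.
- have := le_diam g s m u v gc1; rewrite su um sv vm => /(_ isT isT); lra.
- apply: (le_trans (ler_distD (g m) _ _)); apply: lerD; apply: le_diam => //;
    by rewrite ?su ?vt ?um ?sm ?mt ?lexx ?(ltW mv).
- rewrite [leRHS]addrC; apply: (le_trans (ler_distD (g m) _ _)); apply: lerD;
    by apply: le_diam => //; rewrite ?sv ?ut ?vm ?sm ?mt ?lexx ?(ltW mu).
- have := le_diam g m t u v gc2; rewrite ut vt (ltW mu) (ltW mv) => /(_ isT isT); lra.
Qed.

(** Near [x] the curve stays in a small ball about [g x], so that the pieces
    between [x] and nearby parameters have small diameter. *)
Lemma ects_diam_increment a b g (F : R -> R) : ects a b g ->
  (forall s t, a <= s -> s <= t -> t <= b -> `|F s - F t| <= diam (piece g s t)) ->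
  ects a b F.
Proof.
move=> gc FP x /andP[ax xb] e e0.
have [||d d0 dP] := gc x _ (e / 4); [by rewrite ax|lra|].
have close y z u : x - d < y -> z < x + d -> y <= u <= z -> `|x - u| < d.
  by move=> yd zd /andP[yu uz]; rewrite ltr_distlC (lt_le_trans yd yu) (le_lt_trans uz zd).
have small u v : a <= u <= b -> a <= v <= b -> `|x - u| < d -> `|x - v| < d ->
    `|g u - g v| <= e / 2.
  move=> uab vab xu xv; apply: (le_trans (ler_distD (g x) _ _)).
  have := dP u uab xu; have := dP v vab xv; rewrite (distrC (g u)); lra.
exists d => // y /andP[ay yb]; rewrite ltr_distlC => /andP[xy1 xy2].
have [xd1 xd2] : x - d < x /\ x < x + d by rewrite gtrBl ltrDl d0.
have [xy|/ltW yx] := leP x y.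
  apply: (le_lt_trans (FP x y ax xy yb)); apply: (@le_lt_trans _ _ (e / 2)); last lra.
  apply: diam_le => // u v uP vP; apply: small;
    by [exact: itv_sub uP|exact: itv_sub vP|exact: close uP|exact: close vP].
rewrite distrC; apply: (le_lt_trans (FP y x ay yx xb)).
apply: (@le_lt_trans _ _ (e / 2)); last lra.
apply: diam_le => // u v uP vP; apply: small;
  by [exact: itv_sub uP|exact: itv_sub vP|exact: close uP|exact: close vP].
Qed.

Lemma ects_diamL a b g : ects a b g -> ects (V := R) a b (fun t => diam (piece g a t)).
Proof.
move=> gc; apply: (ects_diam_increment _ _ _ _ gc) => s t a_s st tb.
have gt : ects a t g by apply: ects_sub gc.
have := diam_cat _ _ _ _ a_s st gt; have := diam_mono g a s a t (lexx _) a_s st gt.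
by rewrite ler_norml; lra.
Qed.

Lemma ects_diamR a b g : ects a b g -> ects (V := R) a b (fun t => diam (piece g t b)).
Proof.
move=> gc; apply: (ects_diam_increment _ _ _ _ gc) => s t a_s st tb.
have gt : ects s b g by apply: ects_sub gc.
have := diam_cat _ _ _ _ st tb gt; have := diam_mono g t b s b st tb (lexx _) gt.
by rewrite ler_norml; lra.
Qed.

Lemma piece_rev g s t : piece (fun x => g (- x)) (- t) (- s) = piece g s t.
Proof.
apply/seteqP; split=> x /pieceP[u /andP[? ?] <-]; apply/pieceP; exists (- u);
  by rewrite ?opprK//; apply/andP; split; lra.
Qed.

Lemma piece_sub_domain a b g G s t : g @` `[a, b] `<=` G -> a <= s -> t <= b ->
  forall u, s <= u <= t -> G (g u).
Proof.
move=> gG a_s tb u uP; apply: gG; exists u => //=.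
by rewrite in_itv; exact: itv_sub uP.
Qed.

Lemma le_dist_piece G g s t r : s <= t -> bdry G !=set0 ->
  (forall u, s <= u <= t -> r <= bdist G (g u)) -> r <= dist (piece g s t) (bdry G).
Proof.
move=> st [w wG] rP; apply: lb_le_inf.
  exists `|g s - w|, (g s); first by apply/pieceP; exists s; rewrite ?lexx.
  by exists w.
move=> _ [x /pieceP[u uP <-] [y yG ->]].
by apply: le_trans (bdist_le G (g u) y yG); exact: rP.
Qed.

Lemma dist_le_bdist (A : set E) G x : bdry G !=set0 -> A x ->
  dist A (bdry G) <= bdist G x.
Proof.
move=> G0 Ax; apply: le_bdist => // w wG; apply: ge_inf; last by exists x => //; exists w.
by exists 0 => _ [y _ [z _ ->]].
Qed.

(** Some point of the piece is almost as close to the boundary as the distance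
    says, and the other points are within the diameter of it. *)
Lemma bdist_le_dist_diam G g s t u : bdry G !=set0 -> ects s t g -> s <= u <= t ->
  bdist G (g u) <= dist (piece g s t) (bdry G) + diam (piece g s t).
Proof.
move=> G0 gc uP; rewrite -lerBlDr.
have st : s <= t by case/andP: uP => /le_trans; apply.
apply: le_dist_piece => // v vP.
by have := bdist_lip G (g u) (g v) G0; have := le_diam g s t u v gc uP vP; lra.
Qed.

End diameter.

(** * Quasihyperbolic length of Lipschitz curves *)

Section quasihyperbolic.
Context {R : realType}.

(** Monotonicity straight from the definition of the integral of a nonnegative
    function as a supremum over the simple functions below it. It serves to
    compare [1 / bdist] along a curve with explicit functions. *)
Lemma le_integral_nonneg (D D' : set R) (f g : R -> \bar R) : D `<=` D' ->
  (forall x, D' x -> (0 <= g x)%E) -> (forall x, D x -> (0 <= f x <= g x)%E) ->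
  (\int[@lebesgue_measure R]_(x in D) f x <= \int[@lebesgue_measure R]_(x in D') g x)%E.
Proof.
move=> DD' g0 fg; rewrite !ge0_integralE//; last by move=> x /fg/andP[].
apply: ereal_sup_le => _ [h hf <-]; exists h => // x; apply: le_trans (hf x) _.
rewrite /patch; case: ifPn => [|_].
  by rewrite inE => Dx; rewrite (mem_set (DD' x Dx)); case/andP: (fg x Dx).
by case: ifPn => //; rewrite inE => /g0.
Qed.

Lemma integral_inv_affine (m l : R) : 0 < m -> 0 < l ->
  (\int[@lebesgue_measure R]_(x in `[0%R, l]) ((m + l - x)^-1)%:E
     = (ln (m + l) - ln m)%:E)%E.
Proof.
move=> m0 l0; pose F x : R := - ln (m + l - x).
have FD (x : R) : x < m + l -> is_derive x 1 F (m + l - x)^-1.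
  move=> xml; have y0 : 0 < m + l - x by lra.
  have D1 := is_derive1_ln y0.
  have D2 : is_derive x 1 (fun x : R => m + l - x) (-1).
    have -> : -1 = 0 - 1 :> R by lra.
    exact: is_deriveB.
  have D3 := is_derive1_comp (g := fun x : R => m + l - x) D1 D2.
  have := is_deriveN D3.
  by rewrite mulrN1 opprK.
have fc x : x < m + l -> {for x, continuous (fun x : R => (m + l - x)^-1)}.
  move=> xml; apply: cvgV; first by rewrite gt_eqF//; lra.
  by apply: cvgB; [exact: cvg_cst|exact: cvg_id].
have Fc x : x < m + l -> {for x, continuous F}.
  by move=> /FD D; apply/differentiable_continuous/derivable1_diffP.
rewrite (continuous_FTC2 (F := F) l0).
- by rewrite /F -EFinB subr0 addrK opprK addrC.
- apply: continuous_in_subspaceT => x; rewrite inE /= in_itv /= => /andP[_ xl].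
  by apply: fc; lra.
- split.
  + move=> x; rewrite in_itv /= => /andP[_ xl]; have xml : x < m + l by lra.
    by have [] := FD x xml.
  + by apply: cvg_at_right_filter; apply: Fc; lra.
  + by apply: cvg_at_left_filter; apply: Fc; lra.
- move=> x; rewrite in_itv /= => /andP[_ xl]; rewrite derive1E.
  by apply: derive_val; apply: FD; lra.
Qed.

Context {E : completeNormedModType R}.
Implicit Types (G : set E) (g h : R -> E).

(** Near the point [h l] the distance to the boundary is at most
    [bdist G (h l) + |l - x|] at arc length [x], so that the quasihyperbolic
    length of [[0, l]] is at least the logarithm of
    [(bdist G (h l) + l) / bdist G (h l)]. *)
Lemma qh_length_bdist G h L M l : open G -> bdry G !=set0 -> lip1 0 L h ->
  (forall x, G (h x)) -> 0 <= l <= L ->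
  (\int[@lebesgue_measure R]_(x in `[0%R, L]) ((bdist G (h x))^-1)%:E <= M%:E)%E ->
  bdist G (h l) + l <= expR M * bdist G (h l).
Proof.
move=> Go G0 hl hG /andP[l0 lL] hM.
have h0 x : 0 < bdist G (h x) by exact: bdist_gt0.
set m := bdist G (h l); have m0 : 0 < m by exact: h0.
have M0 : 0 <= M.
  rewrite -lee_fin; apply: le_trans hM; apply: integral_ge0 => x _.
  by rewrite lee_fin invr_ge0 ltW.
move: l0; rewrite le_eqVlt => /predU1P[<-|l0].
  by rewrite addr0 ler_peMl ?(ltW m0)// -[leLHS](@expR0 R) ler_expR.
have : (\int[@lebesgue_measure R]_(x in `[0%R, l]) ((m + l - x)^-1)%:E <= M%:E)%E.
  apply: le_trans hM; apply: le_integral_nonneg.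
  - move=> x /=; rewrite !in_itv /= => /andP[x0 xl]; apply/andP; split; lra.
  - by move=> x _; rewrite lee_fin invr_ge0 ltW.
  move=> x /=; rewrite !in_itv /= => /andP[x0 xl]; rewrite !lee_fin.
  apply/andP; split; first by rewrite invr_ge0; lra.
  rewrite lef_pV2 ?posrE//; last lra.
  by have := bdist_lip G (h x) (h l) G0; have := hl x l x0 xl lL; rewrite -/m; lra.
rewrite integral_inv_affine// lee_fin -ln_div ?posrE//; last lra.
rewrite -ler_expR lnK ?posrE ?ler_pdivrMr//.
by rewrite divr_gt0//; lra.
Qed.


Lemma qh_dist_le G h a b s t r : 0 < r -> a <= s -> s <= t -> t <= b ->
  lip1 a b h -> {in `[a, b] &, injective h} ->
  (forall u, a <= u <= b -> G (h u)) -> (forall u, s <= u <= t -> r <= bdist G (h u)) ->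
  (qh_dist G (h s) (h t) <= ((t - s) / r)%:E)%E.
Proof.
move=> r0 a_s st tb hl hi hG hr.
have hl' : lip1 s t h by exact: lip1_sub hl.
have hc : ects s t h by exact: lip1_ects.
have lenle := length_lip s t h st hl'.
have [L Lle hL] : exists2 L, L <= t - s & length s t h = L%:E.
  have := length_ge0 s t h st; move: lenle.
  by case: (length s t h) => [L| |]//; rewrite lee_fin => ? _; exists L.
apply: (@le_trans _ _ (qh_length G s t h)).
  apply: ereal_inf_lbound; exists s, t, h; split => //.
  - split => //; first exact: ects_within.
    by move=> _ [u /= + <-]; rewrite in_itv => uP; apply: hG; exact: itv_sub uP.
  - by move=> u v; rewrite !in_itv /= => uP vP; apply: hi; rewrite in_itv;
      [exact: itv_sub uP|exact: itv_sub vP].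
  - by rewrite /rectifiable hL ltry.
have [L0 _ _ _ hP] := arclength_param_lip1 s t h L st hc hL.
rewrite /qh_length hL /=.
apply: (@le_trans _ _ (\int[@lebesgue_measure R]_(x in `[0%R, L]) cst (r^-1)%:E x)%E).
  apply: le_integral_nonneg => // x _; first by rewrite lee_fin invr_ge0 ltW.
  have [u uP ->] := hP x; have rb := hr u uP; rewrite !lee_fin.
  rewrite invr_ge0 (le_trans (ltW r0) rb) /= lef_pV2 ?posrE//.
  exact: lt_le_trans rb.
rewrite integral_cst//= lebesgue_measure_itv/= lte_fin -EFinB subr0.
case: ifPn => _; first by rewrite -EFinM lee_fin mulrC ler_pM2r ?invr_gt0.
by rewrite mule0 lee_fin divr_ge0 ?subr_ge0// ltW.
Qed.

End quasihyperbolic.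

(** * Loop erasure *)

Section loop_erasure.
Context {R : realType} {E : completeNormedModType R}.
Implicit Types (g h : R -> E) (a b s t l e L : R) (p q : E).

Lemma seg_inj p q s t : p != q -> seg p q s = seg p q t -> s = t.
Proof.
move=> pq /addrI /eqP; rewrite -subr_eq0 -scalerBl scaler_eq0 subr_eq0.
rewrite (subr_eq0 q) [q == p]eq_sym (negPf pq) orbF => /eqP.
by apply: mulIf; rewrite invr_eq0 normr_eq0 subr_eq0 eq_sym.
Qed.

(** Prolong an arc by a segment issuing from its end: the part of the arc after
    the last point of the segment that lies on the arc is thrown away. *)
Lemma arc_extend h L q : 0 <= L -> lip1 0 L h -> {in `[0, L] &, injective h} ->
  exists L' h' t, [/\ 0 <= t <= L, t <= L' <= t + `|q - h L|,
    lip1 0 L' h', {in `[0, L'] &, injective h'} &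
    [/\ h' L' = q, forall l, l <= t -> h' l = h l &
        forall l, t <= l <= L' -> `|h' l - h L| <= `|q - h L|]].
Proof.
move=> L0 hl hi; set p := h L; set v := `|q - p|.
have [qp|qp] := eqVneq q p.
  exists L, h, L; split=> //; first by rewrite L0 lexx.
    by rewrite lexx lerDl normr_ge0.
  split=> // l /andP[l1 l2]; have -> : l = L by apply/eqP; rewrite eq_le l1 l2.
  by rewrite /p subrr normr0 /v normr_ge0.
have v0 : 0 < v by rewrite normr_gt0 subr_eq0.
pose k := seg p q; have kl c d : lip1 c d k by exact: lip1_seg.
pose S := [set t : R | 0 <= t <= v /\ exists2 l, 0 <= l <= L & h l = k t].
have S0 : S 0.
  by split; [rewrite lexx ltW|exists L; rewrite ?L0 ?lexx// /k seg0].
have Sv : ubound S v by move=> t [/andP[]].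
have Ssup : has_sup S by split; [exists 0|exists v].
pose s := sup S.
have s0 : 0 <= s by apply: sup_upper_bound S0.
have sv : s <= v by apply: ge_sup => //; exists 0.
(* The supremum is attained: on the compact arc the distance to the point [k s]
   has a minimum, which is below every positive number. *)
have [t /andP[t0 tL] tk] : exists2 t, 0 <= t <= L & h t = k s.
  have hc := lip1_ects _ _ _ hl.
  have nc : ects (V := R) 0 L (fun l => `|h l - k s|).
    apply: (ects_lip _ _ _ _ hc) => x y _ _.
    by apply: (le_trans (ler_dist_dist _ _)); rewrite opprB addrA subrK.
  have [t tL tmin] := EVT_min L0 (ects_within _ _ _ nc).
  exists t; first by move: tL; rewrite in_itv.
  apply/eqP; rewrite -subr_eq0 -normr_eq0 eq_le normr_ge0 andbT.
  apply/ler_addgt0Pr => e e0.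
  have [u [/andP[u0 uv] [l lL lu]] us] := sup_adherent e0 Ssup.
  have us' : u <= s by apply: (sup_upper_bound Ssup); split; [rewrite u0|exists l].
  rewrite add0r; apply: (le_trans (tmin l _)); first by rewrite in_itv.
  by rewrite lu; apply: (le_trans (kl u s u s (lexx _) us' (lexx _))); rewrite -/s in us; lra.
pose k' l := k (s + (l - t)); pose h' := glue t h k'.
have hk : h t = k' t by rewrite /k' subrr addr0.
have k'l c d : lip1 c d k'.
  by move=> x y _ xy _; apply: (le_trans (kl (s + (x - t)) (s + (y - t)) _ _ _ _ _)); lra.
have fresh x y : 0 <= x <= t -> t < y <= t + (v - s) -> h x <> k' y.
  move=> /andP[x0 xt] /andP[ty yv] hxy.
  suff : S (s + (y - t)) by move/(sup_upper_bound Ssup); rewrite -/s; lra.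
  by split; [apply/andP; split; lra|exists x => //; rewrite x0; lra].
exists (t + (v - s)), h', t; split.
- by rewrite t0.
- by apply/andP; split; lra.
- by apply: lip1_glue => //; exact: lip1_sub hl.
- move=> x y; rewrite !in_itv /= => /andP[x0 xv] /andP[y0 yv].
  have [xt|tx] := leP x t; have [yt|ty] := leP y t.
  + rewrite /h' !glueL//; apply: hi; rewrite in_itv /= ?x0 ?y0;
      [exact: le_trans tL|exact: le_trans tL].
  + rewrite /h' glueL// (glueR _ _ _ _ hk (ltW ty)) => /fresh[]; rewrite ?x0 ?ty//.
  + rewrite /h' (glueR _ _ _ _ hk (ltW tx)) glueL// => /esym/fresh[]; rewrite ?y0 ?tx//.
  + rewrite /h' !(glueR _ _ _ _ hk) ?(ltW tx) ?(ltW ty)// /k'.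
    move=> /(seg_inj _ _ _ _); rewrite eq_sym => /(_ qp); lra.
- split.
  + by rewrite /h' (glueR _ _ _ _ hk); [rewrite /k' (_ : s + _ = v) ?/k ?seg1//; lra|lra].
  + by move=> l lt; rewrite /h' glueL.
  + move=> l /andP[tl lv]; rewrite /h' (glueR _ _ _ _ hk tl) /k' distrC.
    have := kl 0 v 0 (s + (l - t)) (lexx _); rewrite {1}/k seg0 => H.
    by apply: (le_trans (H _ _)); lra.
Qed.

(** The arc is built while following [g] by segments of length at most [e], with
    [arc_extend] erasing the loops. An erasure only shortens the way from a
    remaining point to either end, which keeps both bounds by lengths of parts
    of [g]. *)
Lemma loop_erasure a b g e : a <= b -> 0 < e -> ects a b g ->
  exists L h, [/\ 0 <= L, lip1 0 L h, {in `[0, L] &, injective h},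
    h 0 = g a /\ h L = g b &
    forall l, 0 <= l <= L -> exists2 s, a <= s <= b &
      [/\ `|g s - h l| <= e, (l%:E <= length a s g + e%:E)%E &
          ((L - l)%:E <= length s b g + e%:E)%E]].
Proof.
move=> ab e0 gc.
(* The parameters [t] with [claim t] have a supremum: one more segment gives the
   claim there, and another one beyond it if it is less than [b]. *)
pose claim t := exists L h, [/\ [/\ 0 <= L, lip1 0 L h & {in `[0, L] &, injective h}],
    h 0 = g a, h L = g t, (L%:E <= length a t g)%E &
    forall l, 0 <= l <= L -> exists2 s, a <= s <= t &
      [/\ `|g s - h l| <= e, (l%:E <= length a s g + e%:E)%E &
          ((L - l)%:E <= length s t g + e%:E)%E]].
have step t u : a <= t -> t <= u -> `|g t - g u| <= e -> claim t -> claim u.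
  move=> a_t tu gtu [L [h [[L0 hl hi] ha ht Lt hP]]].
  have [L' [h' [v [/andP[v0 vL] /andP[vL' L'v] hl' hi' [hu' hv hv']]]]] :=
    arc_extend h L (g u) L0 hl hi.
  rewrite ht distrC in L'v hv'.
  have chord := chord_le_length t u g tu.
  exists L', h'; split=> //; first by split=> //; lra.
  - by rewrite hv.
  - apply: le_trans (length_superadd a t u g a_t tu).
    by apply: (@le_trans _ _ (L%:E + `|g t - g u|%:E)%E);
      [rewrite -EFinD lee_fin; lra|exact: leeD].
  move=> l /andP[l0 lL']; have [lv|vl] := leP l v; last first.
    exists t; rewrite ?a_t//; split.
    - by rewrite distrC; apply: (le_trans (hv' l _)) => //; rewrite ltW.
    - apply: (@le_trans _ _ (L%:E + e%:E)%E); last exact: leeD2r.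
      by rewrite -EFinD lee_fin; lra.
    - apply: (@le_trans _ _ (e%:E)); first by rewrite lee_fin; lra.
      by apply: leeDr; exact: length_ge0.
  have [|s /andP[a_s st] [gs ls Ls]] := hP l; first by rewrite l0; lra.
  exists s; first by rewrite a_s (le_trans st).
  split=> //; first by rewrite hv.
  apply: (@le_trans _ _ ((L - l)%:E + `|g t - g u|%:E)%E).
    by rewrite -EFinD lee_fin; lra.
  apply: (le_trans (leeD Ls chord)); rewrite addeAC; apply: leeD2r.
  exact: length_superadd.
pose S := [set t : R | a <= t <= b /\ claim t].
have Sa : S a.
  split; first by rewrite lexx.
  exists 0, (fun=> g a); split=> //.
  - split=> //; first by move=> s t _ st _; rewrite subrr normr0 subr_ge0.
    move=> x y; rewrite !in_itv /= => /andP[? ?] /andP[? ?] _; lra.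
  - exact: length_ge0.
  move=> l /andP[l0 l1]; have -> : l = 0 by lra.
  exists a; first by rewrite lexx.
  have ge0 : (0 <= length a a g + e%:E)%E.
    by rewrite adde_ge0// ?length_ge0// lee_fin ltW.
  by rewrite !subrr normr0; split => //; exact: ltW.
have Sb : ubound S b by move=> t [/andP[]].
have Ssup : has_sup S by split; [exists a|exists b].
pose T := sup S.
have aT : a <= T by apply: sup_upper_bound Sa.
have Tb : T <= b by apply: ge_sup => //; exists a.
have [|d d0 dP] := gc T _ e e0; first by rewrite aT.
have [t [/andP[a_t tb] ct] Tt] := sup_adherent d0 Ssup.
rewrite -/T in Tt.
have tT : t <= T by apply: sup_upper_bound => //; split=> //; rewrite a_t.
have cT : claim T.
  apply: (step t) => //; rewrite distrC; apply/ltW/dP; first by rewrite a_t.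
  by rewrite ger0_norm; lra.
have TB : T = b.
  apply/eqP; rewrite eq_le Tb leNgt; apply/negP => ltTb.
  pose u := Num.min b (T + d / 2).
  have Tu : T < u by rewrite lt_min ltTb; lra.
  have ub : u <= b by rewrite ge_min lexx.
  have ud : u <= T + d / 2 by rewrite ge_min lexx orbT.
  suff /(sup_upper_bound Ssup) : S u by rewrite -/T; lra.
  split; first by apply/andP; split; lra.
  apply: (step T) => //; first lra.
  by apply/ltW/dP; rewrite ?ltr_norml; apply/andP; split; lra.
rewrite TB in cT; have [L [h [[L0 hl hi] ha hb _ hP]]] := cT.
by exists L, h.
Qed.

End loop_erasure.

(** * Arcs in length John domains satisfy the natural condition *)

Section john_arcs.
Context {R : realType} {E : completeNormedModType R}.
Implicit Types (G : set E) (g h : R -> E) (c L : R).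

Lemma bdist_min G g a b : a <= b -> ects a b g -> open G -> bdry G !=set0 ->
  (forall t, a <= t <= b -> G (g t)) ->
  exists2 d, 0 < d & forall t, a <= t <= b -> d <= bdist G (g t).
Proof.
move=> ab gc Go G0 gG.
have bc : ects (V := R) a b (fun t => bdist G (g t)).
  apply: (ects_lip _ _ _ _ gc) => s t _ _.
  have := bdist_lip G (g s) (g t) G0; have := bdist_lip G (g t) (g s) G0.
  by rewrite (distrC (g t)) ler_norml; lra.
have [m mab mP] := EVT_min ab (ects_within _ _ _ bc).
exists (bdist G (g m)) => [|t tab]; last by apply: mP; rewrite in_itv.
by apply: bdist_gt0 => //; apply: gG; move: mab; rewrite in_itv.
Qed.

(** The loop erasure is made at a scale [d / 4] small compared to the minimal
    distance [d] of the curve to the boundary, so that neither the distance to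
    the boundary nor the lengths are spoilt by more than a factor. *)
Lemma john_arc G g a b c : 1 <= c -> open G -> bdry G !=set0 ->
  curve_in G a b g -> length_john_curve c G a b g ->
  exists L h r, [/\ 0 <= L, lip1 0 L h, {in `[0, L] &, injective h},
    h 0 = g a /\ h L = g b &
    [/\ 0 < r, forall l, 0 <= l <= L -> G (h l) /\ r <= bdist G (h l) &
      forall l, 0 <= l <= L -> Num.min l (L - l) <= 2 * c * bdist G (h l)]].
Proof.
move=> c1 Go G0 [ab /within_ects gc gG] gJ.
have gG' : forall t, a <= t <= b -> G (g t).
  by apply: piece_sub_domain gG _ _.
have [d d0 dP] := bdist_min G g a b ab gc Go G0 gG'.
have [|L [h [L0 hl hi hab hP]]] := loop_erasure a b g (d / 4) ab _ gc; first lra.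
have far s l : a <= s <= b -> `|g s - h l| <= d / 4 ->
    [/\ G (h l), 3 * d / 4 <= bdist G (h l) & bdist G (g s) <= bdist G (h l) + d / 4].
  move=> sab sl; have ds := dP s sab; have := bdist_lip G (g s) (h l) G0.
  by split; [apply: (bdist_ball G (g s)) => //; [exact: gG'|lra]|lra|lra].
exists L, h, (3 * d / 4); split=> //; split; first lra.
  by move=> l /hP[s sab [sl _ _]]; have [] := far s l sab sl.
move=> l lL; have [s sab [sl ls Ls]] := hP l lL.
have [_ hl3 hl4] := far s l sab sl.
have cd : c * bdist G (g s) <= c * (bdist G (h l) + d / 4) by rewrite ler_pM2l//; lra.
have d4 : d / 4 <= c * (d / 4) by rewrite ler_peMl//; lra.
have d3 : c * (3 * d / 4) <= c * bdist G (h l) by rewrite ler_pM2l//; lra.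
have key (x : \bar R) (y : R) : (x <= (c * bdist G (g s))%:E)%E ->
    (y%:E <= x + (d / 4)%:E)%E -> y <= 2 * c * bdist G (h l).
  move=> xc yx; rewrite -lee_fin; apply: (le_trans yx).
  apply: (le_trans (leeD2r _ xc)); rewrite -EFinD lee_fin; lra.
have := gJ s; rewrite in_itv => /(_ sab); rewrite !ge_min => /orP[js|js]; apply/orP.
  by left; exact: key ls.
by right; exact: key Ls.
Qed.

(** At each end of the piece, or at [L / 2] if the piece contains that parameter,
    the John condition and [bdist <= d + D] bound the parameter length. As
    [qh_dist] is defined by oriented arcs, two points in the wrong order are
    joined by a part of the reversed arc. *)
Lemma john_arc_natural G h L r C (psi := fun x : R => 2 * C * (1 + x)) :
  0 <= C -> open G -> bdry G !=set0 -> 0 <= L -> lip1 0 L h ->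
  {in `[0, L] &, injective h} -> 0 < r ->
  (forall l, 0 <= l <= L -> G (h l) /\ r <= bdist G (h l)) ->
  (forall l, 0 <= l <= L -> Num.min l (L - l) <= C * bdist G (h l)) ->
  natural_condition psi G 0 L h.
Proof.
move=> C0 Go G0 L0 hl hi r0 hG hJ s t s0 st tL.
have hc : ects s t h by apply: lip1_ects; exact: lip1_sub hl.
set D := diam _; set d := dist _ _.
have D0 : 0 <= D by exact: diam_ge0.
have in0L u : s <= u <= t -> 0 <= u <= L.
  exact: itv_sub.
have d0 : 0 < d.
  by apply: (lt_le_trans r0); apply: le_dist_piece => // u /in0L/hG[].
have dD u : s <= u <= t -> bdist G (h u) <= d + D.
  by move=> uP; exact: bdist_le_dist_diam.
have uJ u : s <= u <= t -> Num.min u (L - u) <= C * (d + D).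
  move=> uP; apply: (le_trans (hJ u (in0L u uP))).
  by apply: ler_wpM2l => //; exact: dD.
have len : t - s <= 2 * C * (d + D).
  have CdD : 0 <= C * (d + D) by apply: mulr_ge0 => //; lra.
  have [tL2|tL2] := leP t (L / 2).
    have := uJ t; rewrite st lexx => /(_ isT); rewrite minEle; case: ifPn => [_|/negP []]; lra.
  have [sL2|sL2] := leP (L / 2) s.
    have := uJ s; rewrite st lexx => /(_ isT); rewrite minElt; case: ifPn => [|_]; lra.
  have := uJ (L / 2); rewrite (ltW sL2) (ltW tL2) => /(_ isT).
  rewrite minEle; case: ifPn => [_|/negP []]; lra.
have len' : (t - s) / d <= psi (D / d).
  have -> : psi (D / d) = 2 * C * (d + D) / d by rewrite /psi; field; rewrite gt_eqF.
  by rewrite ler_pM2r ?invr_gt0.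
have near w : s <= w <= t -> d <= bdist G (h w).
  by move=> wP; apply: dist_le_bdist => //; apply/pieceP; exists w.
have short x y : s <= x -> y <= t -> (((y - x) / d)%:E <= (psi (D / d))%:E)%E.
  move=> sx yt; rewrite lee_fin; apply: le_trans len'.
  by rewrite ler_pM2r ?invr_gt0// lerB.
have qh u v : s <= u <= t -> s <= v <= t ->
    (qh_dist G (h u) (h v) <= (psi (D / d))%:E)%E.
  move=> uP vP; have [/andP[su ut] /andP[sv vt]] := (uP, vP).
  have [/andP[u0 uL] /andP[v0 vL]] := (in0L u uP, in0L v vP).
  have [uv|/ltW vu] := leP u v.
    apply: (@le_trans _ _ ((v - u) / d)%:E).
      apply: (qh_dist_le G h 0 L) => //; first by move=> w /hG[].
      by move=> w wP; apply: near; exact: itv_sub wP.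
    exact: short.
  apply: (@le_trans _ _ ((- v - - u) / d)%:E).
    rewrite -{1}(opprK u) -{1}(opprK v).
    apply: (qh_dist_le G (fun x => h (- x)) (- L) (- 0)) => //; rewrite ?lerN2//.
    - exact: lip1_rev.
    - move=> x y; rewrite !in_itv /= => /itv_rev xP /itv_rev yP /hi hxy; apply: oppr_inj.
      by apply: hxy; rewrite in_itv.
    - by move=> w /itv_rev/hG[].
    - by move=> w /itv_rev wP; apply: near; exact: itv_sub wP.
  by rewrite opprK addrC; exact: short.
by apply: ge_ereal_sup => _ [_ /pieceP[u uP <-] [_ /pieceP[v vP <-] ->]]; exact: qh.
Qed.

End john_arcs.

(** * From diameter John curves to length John curves *)

Section diameter_john.
Context {R : realType} {E : completeNormedModType R}.
Implicit Types (G : set E) (g h : R -> E) (a b c M L C : R).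

(** As in a cone with vertex [x], the distance to the boundary grows at least
    proportionally to the distance from the vertex along the curve. *)
Definition cone C G x y L h := [/\ 0 <= L, lip1 0 L h, h 0 = x, h L = y &
  forall l, 0 <= l <= L -> G (h l) /\ l <= C * bdist G (h l)].

(** An almost optimal arc, parametrized by arc length: the logarithmic lower
    bound for its quasihyperbolic length becomes an exponential upper bound for
    both the length and the ratio of the distances to the boundary. *)
Lemma qh_short_path G x y M : open G -> bdry G !=set0 -> (qh_dist G x y < M%:E)%E ->
  exists L h, [/\ 0 <= L, lip1 0 L h, h 0 = x, h L = y & forall l, 0 <= l <= L ->
    G (h l) /\ bdist G (h l) + l <= expR M * bdist G (h l)].
Proof.
move=> Go G0 /ereal_inf_lt[_ [a [b [g [[ab /within_ects gc gG] _ gr [ga gb] ->]]]] gM].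
have [L gL] : exists L, length a b g = L%:E.
  move: gr (length_ge0 _ _ g ab); rewrite /rectifiable.
  by case: (length a b g) => // L; exists L.
have [L0 hl h0 hL hP] := arclength_param_lip1 a b g L ab gc gL.
have hG l : G (arclength_param a b g l).
  by have [t tab ->] := hP l; apply: gG; exists t; rewrite //= in_itv.
exists L, (arclength_param a b g); split=> //; rewrite ?h0 ?hL// => l lL; split=> //.
apply: (qh_length_bdist G _ L M l Go G0 hl hG lL).
by move: gM; rewrite /qh_length gL => /ltW.
Qed.

(** Induction on the number of times that the diameter [D t] has to be halved to
    get below half of [bdist G (g a)]. The bound [L <= K * D t] goes through the
    induction because half of it is inherited from [D s = D t / 2] and the other
    half pays for the new arc, of length at most [expR M * (3 * D t)]; this
    explains the value of [K]. On the new arc, [D t <= 2 * c * bdist (g s)] and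
    [bdist (g s)] is at most [expR M] times the distance to the boundary; this
    explains the value of [C]. *)
Lemma cone_half C K M c G g a b : 1 <= c -> 0 <= M -> K = 6 * expR M ->
  C = 2 * c * K * expR M -> open G -> bdry G !=set0 ->
  a <= b -> ects a b g -> (forall t, a <= t <= b -> G (g t)) ->
  (forall t, a <= t <= b -> diam (piece g a t) <= c * bdist G (g t)) ->
  (forall s t, a <= s -> s <= t -> t <= b ->
     diam (piece g s t) <= 2 * c * dist (piece g s t) (bdry G) ->
     0 < dist (piece g s t) (bdry G) -> (qh_dist G (g s) (g t) < M%:E)%E) ->
  exists L h, cone C G (g a) (g b) L h.
Proof.
move=> c1 M0 KE CE Go G0 ab gc gG gJ gk.
have c0 : 0 <= 2 * c by lra.
have cp : 0 < c by lra.
have e1 : 1 <= expR M by rewrite -[leLHS](@expR0 R) ler_expR.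
have K6 : 6 <= K by rewrite KE; lra.
have K0 : 0 <= K by lra.
have KC : K <= C.
  rewrite CE -[leLHS]mulr1; apply: ler_pM => //; try lra.
  rewrite -[leLHS]mul1r; apply: ler_pM => //; lra.
set m := bdist G (g a); pose D t := diam (piece g a t).
have m0 : 0 < m by apply: bdist_gt0 => //; apply: gG; rewrite lexx.
have sub s t : a <= s -> t <= b -> ects s t g by move=> ? ?; exact: ects_sub gc.
have D0 t : a <= t <= b -> 0 <= D t.
  by move=> /andP[? ?]; apply: diam_ge0 => //; exact: sub.
have DM s t : a <= s -> s <= t -> t <= b -> D s <= D t.
  by move=> ? ? ?; apply: diam_mono => //; exact: sub.
have gD t : a <= t <= b -> `|g a - g t| <= D t.
  by move=> /andP[? ?]; apply: le_diam; [exact: sub|rewrite lexx|apply/andP].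
have main n t : a <= t <= b -> D t <= 2 ^+ n * (m / 2) ->
    exists L h, cone C G (g a) (g t) L h /\ L <= K * D t.
  elim: n t => [|n IH] t tab Dt.
    rewrite expr0 mul1r in Dt; have gDt := gD t tab; rewrite distrC in gDt.
    (* The ball of radius [m] about [g a] lies in [G], and the segment stays in
       the ball of half that radius. *)
    exists `|g t - g a|, (seg (g a) (g t)); split.
      have sl := lip1_seg 0 `|g t - g a| (g a) (g t).
      split=> //; [exact: seg0|exact: seg1|move=> l /andP[l0 lL]].
      have hl := sl 0 l (lexx _) l0 lL; rewrite seg0 subr0 in hl.
      have hb := bdist_lip G (g a) (seg (g a) (g t) l) G0; rewrite -/m in hb.
      split.
        apply: (bdist_ball G (g a)) => //; first by apply: gG; rewrite lexx.
        by rewrite -/m; lra.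
      apply: (@le_trans _ _ (1 * bdist G (seg (g a) (g t) l))); first lra.
      by apply: ler_wpM2r; lra.
    by have := D0 t tab => D0t; rewrite -[leLHS]mul1r; apply: ler_pM => //; lra.
  have [|nDt] := leP (D t) (2 ^+ n * (m / 2)); first exact: IH.
  have [a_t tb] := andP tab.
  have mD : m / 2 <= D t.
    by apply/ltW/(le_lt_trans _ nDt); rewrite ler_peMl ?exprn_ege1//; lra.
  have [s] : exists2 s, s \in `[a, t] & D s = D t / 2.
    apply: IVT => //.
      by apply/ects_within/ects_diamL/sub.
    have -> : D a = 0.
      apply/eqP; rewrite eq_le D0 ?lexx// andbT; apply: diam_le => // u v.
      move=> /andP[ua au] /andP[va av].
      have -> : u = a by lra.
      have -> : v = a by lra.
      by rewrite subrr normr0.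
    by rewrite min_l ?max_r//; lra.
  rewrite in_itv /= => /andP[a_s st] Ds; have sb := le_trans st tb.
  have sab : a <= s <= b by rewrite a_s.
  have [|L1 [h1 [[L10 h1l h10 h1L h1P] L1K]]] := IH s sab.
    by rewrite Ds; move: Dt; rewrite exprS; lra.
  have far u : s <= u <= t -> D t / 2 <= c * bdist G (g u).
    move=> /andP[su ut]; rewrite -Ds; apply: (le_trans (DM s u a_s su (le_trans ut tb))).
    by apply: gJ; rewrite (le_trans a_s su) (le_trans ut tb).
  have dst : D t / 2 <= c * dist (piece g s t) (bdry G).
    rewrite -ler_pdivrMl//; apply: le_dist_piece => // u /far uD.
    by rewrite ler_pdivrMl.
  have [|L2 [h2 [L20 h2l h20 h2L h2P]]] := qh_short_path G (g s) (g t) M Go G0.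
    apply: gk => //.
      have : diam (piece g s t) <= D t.
        by apply: diam_mono => //; exact: sub.
      lra.
    by rewrite -(pmulr_rgt0 _ cp) (lt_le_trans _ dst)//; lra.
  have L2D : L2 <= expR M * (3 * D t).
    have [|_] := h2P L2; first by rewrite L20 lexx.
    rewrite h2L => L2e; have bt : bdist G (g t) <= 3 * D t.
      have := bdist_lip G (g t) (g a) G0; have := gD t tab.
      by rewrite distrC -/m; lra.
    have := bdist_gt0 G (g t) Go G0 (gG t tab).
    have : expR M * bdist G (g t) <= expR M * (3 * D t).
      by apply: ler_wpM2l => //; exact: expR_ge0.
    lra.
  have hE : h1 L1 = (fun l => h2 (l - L1)) L1 by rewrite subrr h20.
  have LK : L1 + L2 <= K * D t.
    move: L1K L2D; rewrite Ds KE; lra.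
  exists (L1 + L2), (glue L1 h1 (fun l => h2 (l - L1))); split=> //; split.
  - exact: addr_ge0.
  - apply: lip1_glue => //.
    by have := lip1_shift _ _ L1 _ h2l; rewrite add0r (addrC L2).
  - by rewrite glueL.
  - by rewrite (glueR _ _ _ _ hE) ?lerDl// (addrC L1) addrK.
  move=> l /andP[l0 lL]; have [lL1|/ltW L1l] := leP l L1.
    by rewrite glueL//; apply: h1P; rewrite l0.
  rewrite (glueR _ _ _ _ hE L1l).
  have lL2 : 0 <= l - L1 <= L2 by rewrite subr_ge0 L1l lerBlDl.
  have [hG hb] := h2P _ lL2; split=> //.
  have hs : bdist G (g s) <= expR M * bdist G (h2 (l - L1)).
    apply: (le_trans (bdist_lip G (g s) (h2 (l - L1)) G0)).
    apply: le_trans hb; rewrite lerD2l -h20.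
    by case/andP: lL2 => *; apply: (le_trans (h2l _ _ _ _ _)); rewrite ?subr0//.
  have Dts : D t <= 2 * c * bdist G (g s) by have := far s; rewrite lexx st => /(_ isT); clear; lra.
  apply: (le_trans lL); apply: (le_trans LK); rewrite CE.
  rewrite (_ : _ * _ * K * _ * _ = K * (2 * c * (expR M * bdist G (h2 (l - L1))))); last ring.
  by apply: ler_wpM2l => //; apply: (le_trans Dts); exact: ler_wpM2l.
have [n nP] : exists n, D b <= 2 ^+ n * (m / 2).
  exists (Num.truncn (D b / (m / 2))).+1; rewrite -ler_pdivrMr; last lra.
  apply/ltW/(lt_trans (truncnS_gt _)).
  by rewrite -natrX ltr_nat ltn_expl.
have bab : a <= b <= b by rewrite ab lexx.
by have [L [h [hP _]]] := main n b bab nP; exists L, h.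
Qed.

Lemma glue_cones C G x y z L1 h1 L2 h2 :
  cone C G x z L1 h1 -> cone C G y z L2 h2 ->
  exists a b g, [/\ curve_in G a b g, joins a b g x y & length_john_curve C G a b g].
Proof.
move=> [L10 h1l h10 h1L h1P] [L20 h2l h20 h2L h2P].
pose L := L1 + L2; pose k l := h2 (- (l - L)).
have hk : h1 L1 = k L1 by rewrite /k /L h1L opprB addrAC subrr add0r h2L.
pose h := glue L1 h1 k.
have L0 : 0 <= L by exact: addr_ge0.
have hl : lip1 0 L h.
  apply: lip1_glue => //.
  have := lip1_shift _ _ L _ (lip1_rev _ _ _ h2l).
  by rewrite oppr0 add0r /L (addrC (- _)) addrK.
have kP l : L1 <= l <= L -> G (k l) /\ L - l <= C * bdist G (k l).
  move=> /andP[L1l lL]; have [|? ?] := h2P (- (l - L)).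
    by apply/andP; split; rewrite /L in lL *; lra.
  by split=> //; lra.
have hR l : L1 <= l -> h l = k l by exact: glueR.
exists 0, L, h; split.
- split=> //; first by apply/ects_within/lip1_ects.
  move=> _ [l /= + <-]; rewrite in_itv /= => /andP[l0 lL].
  have [lL1|/ltW L1l] := leP l L1.
    by rewrite /h glueL//; have [] := h1P l; rewrite ?l0.
  by rewrite hR//; have [] := kP l; rewrite ?L1l.
- split; first by rewrite /h glueL.
  by rewrite hR ?lerDl// /k subrr oppr0.
move=> l; rewrite in_itv /= => /andP[l0 lL]; rewrite ge_min; apply/orP.
have [lL1|/ltW L1l] := leP l L1; [left|right].
  apply: (le_trans (length_lip _ _ _ l0 (lip1_sub _ _ _ _ _ (lexx _) lL hl))).
  by rewrite lee_fin subr0 /h glueL//; have [] := h1P l; rewrite ?l0.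
apply: (le_trans (length_lip _ _ _ lL (lip1_sub _ _ _ _ _ l0 (lexx _) hl))).
by rewrite lee_fin hR//; have [] := kP l; rewrite ?L1l.
Qed.

(** At a parameter [m] where the diameters of the two parts agree, the part from
    [a] is the smaller one before [m], and the part to [b] after [m]. *)
Lemma diam_john_mid c G a b g : a <= b -> ects a b g -> diam_john_curve c G a b g ->
  exists m, [/\ a <= m <= b,
    forall t, a <= t <= m -> diam (piece g a t) <= c * bdist G (g t) &
    forall t, m <= t <= b -> diam (piece g t b) <= c * bdist G (g t)].
Proof.
move=> ab gc gJ; pose f t := diam (piece g a t) - diam (piece g t b).
have fc : {within `[a, b], continuous f}.
  have c1 := ects_within _ _ _ (ects_diamL _ _ _ gc).
  have c2 := ects_within _ _ _ (ects_diamR _ _ _ gc).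
  by move=> x; apply: cvgB; [exact: c1|exact: c2].
have d0 t : a <= t <= b -> diam (piece g t t) <= 0.
  move=> tab; apply: diam_le => // u v /andP[tu ut] /andP[tv vt].
  have -> : u = t by lra.
  have -> : v = t by lra.
  by rewrite subrr normr0.
have dab := diam_ge0 _ _ _ ab gc.
have [m] : exists2 m, m \in `[a, b] & f m = 0.
  apply: IVT => //; have := d0 a; have := d0 b; rewrite !lexx ab => /(_ isT) d1 /(_ isT) d2.
  by apply/andP; split; rewrite ?ge_min ?le_max; apply/orP; [left|right]; rewrite /f; lra.
rewrite in_itv /= => /andP[am mb] fm; exists m; split; first by rewrite am.
  move=> t /andP[a_t tm]; have tb : t <= b by lra.
  have e1 : ects a m g by exact: ects_sub gc.
  have e2 : ects t b g by exact: ects_sub gc.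
  have := diam_mono g a t a m (lexx _) a_t tm e1.
  have := diam_mono g m b t b tm mb (lexx _) e2.
  have := gJ t; rewrite in_itv /= a_t tb => /(_ isT); rewrite /f in fm.
  by rewrite minEle; case: ifPn => [//|]; rewrite -ltNge; lra.
move=> t /andP[mt tb]; have a_t : a <= t by lra.
have e1 : ects a t g by exact: ects_sub gc.
have e2 : ects m b g by exact: ects_sub gc.
have := diam_mono g a m a t (lexx _) am mt e1.
have := diam_mono g t b m b mt tb (lexx _) e2.
have := gJ t; rewrite in_itv /= a_t tb => /(_ isT); rewrite /f in fm.
by rewrite minEle; case: ifPn => [|//]; lra.
Qed.

(** Both orders of the points are given, as the half of the curve that starts
    at [g b] is run backwards. *)
Lemma natural_qh_dist (psi : R -> R) c M G g a b s t : nondecreasing_nonneg psi ->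
  psi (2 * c) < M -> ects a b g -> natural_condition psi G a b g ->
  a <= s -> s <= t -> t <= b ->
  diam (piece g s t) <= 2 * c * dist (piece g s t) (bdry G) ->
  0 < dist (piece g s t) (bdry G) ->
  (qh_dist G (g s) (g t) < M%:E)%E /\ (qh_dist G (g t) (g s) < M%:E)%E.
Proof.
move=> psi_nd psiM gc gN a_s st tb Dd d0.
have : (qh_diam G (piece g s t) <= (psi (2 * c))%:E)%E.
  apply: (le_trans (gN s t a_s st tb)); rewrite lee_fin; apply: psi_nd.
    by apply: divr_ge0; [apply: diam_ge0 => //; exact: ects_sub gc|exact: ltW].
  by rewrite ler_pdivrMr.
move=> dk; have ps : piece g s t (g s) by apply/pieceP; exists s; rewrite ?lexx.
have pt : piece g s t (g t) by apply/pieceP; exists t; rewrite ?lexx ?st.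
by split; (apply: le_lt_trans (_ : (psi (2 * c))%:E < M%:E)%E; [|by rewrite lte_fin]);
  apply: le_trans dk; apply: ereal_sup_ubound;
  [exists (g s) => //; exists (g t)|exists (g t) => //; exists (g s)].
Qed.

Lemma length_john_of_diam_john (psi : R -> R) c M C G g a b : 1 <= c ->
  maps_nonneg psi -> nondecreasing_nonneg psi -> psi (2 * c) < M ->
  C = 2 * c * (6 * expR M) * expR M -> open G -> bdry G !=set0 ->
  curve_in G a b g -> diam_john_curve c G a b g -> natural_condition psi G a b g ->
  exists a' b' g', [/\ curve_in G a' b' g', joins a' b' g' (g a) (g b) &
    length_john_curve C G a' b' g'].
Proof.
move=> c1 psi0 psi_nd psiM CE Go G0 [ab /within_ects gc gG] gJ gN.
have M0 : 0 <= M by have := psi0 (2 * c); lra.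
have [m [/andP[am mb] mL mR]] := diam_john_mid c G a b g ab gc gJ.
have gG' := piece_sub_domain a b g G a b gG (lexx _) (lexx _).
have [||s t a_s st tm Dd d0|L1 [h1 h1P]] :=
    cone_half _ _ M c G g a m c1 M0 erefl CE Go G0 am _ _ mL.
- exact: ects_sub gc.
- by move=> t /andP[? ?]; apply: gG'; apply/andP; split; lra.
- have tb : t <= b by lra.
  by have [] := natural_qh_dist psi c M G g a b s t psi_nd psiM gc gN a_s st tb Dd d0.
(* The other half is the same statement for the reversed curve. *)
pose k t := g (- t); have bm : - b <= - m by lra.
have kc : ects (- b) (- m) k by apply: ects_rev; exact: ects_sub gc.
have [||s t bs st tm|L2 [h2]] :=
    cone_half _ _ M c G k (- b) (- m) c1 M0 erefl CE Go G0 bm kc.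
- by move=> t /andP[? ?]; apply: gG'; apply/andP; split; lra.
- move=> t /andP[? ?]; rewrite -{1}(opprK t) piece_rev.
  by apply: mR; apply/andP; split; lra.
- rewrite -(opprK s) -(opprK t) piece_rev => Dd d0; rewrite /k !opprK.
  have at' : a <= - t by lra.
  have ts : - t <= - s by lra.
  have sb : - s <= b by lra.
  by have [] := natural_qh_dist psi c M G g a b _ _ psi_nd psiM gc gN at' ts sb Dd d0.
by rewrite /k !opprK => h2P; exact: glue_cones h1P h2P.
Qed.

End diameter_john.

(** * The two implications *)

Theorem theorem1p14 (R : realType) :
  (forall (E : completeNormedModType R) (c : R) (G : set E),
     dim_ge2 E -> length_john c G ->
     exists psi : R -> R,
       [/\ maps_nonneg psi, increasing_nonneg psi &
         forall x y : E, G x -> G y -> exists (a b : R) (g : R -> E),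
           [/\ curve_in G a b g, is_arc a b g, joins a b g x y &
               natural_condition psi G a b g]])
  /\
  (forall (c : R) (psi : R -> R),
     1 <= c -> maps_nonneg psi -> nondecreasing_nonneg psi ->
     exists2 c' : R, 1 <= c' &
       forall (E : completeNormedModType R) (G : set E),
         dim_ge2 E -> diam_john c G ->
         (forall x y : E, G x -> G y -> exists (a b : R) (g : R -> E),
            [/\ curve_in G a b g, joins a b g x y, diam_john_curve c G a b g &
                natural_condition psi G a b g]) ->
         length_john c' G).
Proof.
split=> [E c G _ [c1 [Go _] GT GJ]|c psi c1 psi0 psi_nd].
  exists (fun x => 2 * (2 * c) * (1 + x)); split.
  - by move=> r r0; apply: mulr_ge0; lra.
  - by move=> r s _ rs; rewrite ltr_pM2l; lra.
  move=> x y Gx Gy; have G0 := bdry_nonempty G x Go Gx GT.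
  have [a [b [g [gG [ga gb] gJ]]]] := GJ x y Gx Gy.
  have [L [h [r [L0 hl hi [h0 hL] [r0 hG hJ]]]]] := john_arc G g a b c c1 Go G0 gG gJ.
  exists 0, L, h; split=> //.
  - split=> //; first by apply/ects_within/lip1_ects.
    by move=> _ [l /= + <-]; rewrite in_itv /= => /hG[].
  - by split; rewrite ?h0 ?hL.
  - by apply: (john_arc_natural G h L r) => //; lra.
pose M := psi (2 * c) + 1; pose C := 2 * c * (6 * expR M) * expR M.
have M0 : 0 <= M by have := psi0 (2 * c); rewrite /M; lra.
have e1 : 1 <= expR M by rewrite -[leLHS](@expR0 R) ler_expR.
exists C.
  rewrite /C -[leLHS]mulr1; apply: ler_pM => //.
  by rewrite -[leLHS]mulr1; apply: ler_pM; lra.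
move=> E G _ [_ Gdom GT _] GJ; split=> //.
  rewrite /C -[leLHS]mulr1; apply: ler_pM => //.
  by rewrite -[leLHS]mulr1; apply: ler_pM; lra.
move=> x y Gx Gy; have [Go _] := Gdom; have G0 := bdry_nonempty G x Go Gx GT.
have [a [b [g [gG [<- <-] gJ gN]]]] := GJ x y Gx Gy.
apply: (length_john_of_diam_john psi c M C G g a b) => //.
by rewrite /M; lra.
Qed.
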